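(* Let $F$ be an $\exists$LIRA transition formula of dimension $n$. Algorithm abstract-VASR (described in the context) terminates on input $F$ and returns a pair $(S,V)$, with $S \in \mathbb{Q}^{d\times n}$ and $V$ a $d$-dimensional $\mathbb{Q}$-VASR, such that $F \Vdash_S V$ (i.e., $(S,V)$ is a $\mathbb{Q}$-VASR abstraction of $F$). Moreover, if $F$ is in $\exists$LRA, then the returned $(S,V)$ is a best $\mathbb{Q}$-VASR abstraction of $F$.
   Context: $\exists$LIRA formulas are built from atoms $s<t$ and $s=t$ over linear terms with rational coefficients using $\land$, $\lor$, $\exists x\in\mathbb{Q}$ and $\exists x \in \mathbb{Z}$; $\exists$LRA is the fragment without quantification over $\mathbb{Z}$. A transition formula of dimension $n$ is a formula $F(\vec x,\vec x')$ with free variables $\vec x=x_1,\dots,x_n$ and $\vec x'=x_1',\dots,x_n'$; it defines the transition system on $\mathbb{Q}^n$ with $\vec u \to_F \vec v$ iff $F(\vec u,\vec v)$ holds. A $\mathbb{Q}$-VASR of dimension $d$ is a finite set $V\subseteq\{0,1\}^d\times\mathbb{Q}^d$ of transformers $(\vec r,\vec a)$; it defines the transition system on $\mathbb{Q}^d$ with $\vec u\to_V\vec v$ iff $\vec v=\vec r*\vec u+\vec a$ for some $(\vec r,\vec a)\in V$, where $*$ is the pointwise product. For transition systems $A=(\mathbb{Q}^n,\to_A)$, $B=(\mathbb{Q}^m,\to_B)$, a linear simulation $A\Vdash_S B$ is a matrix $S\in\mathbb{Q}^{m\times n}$ such that $\vec u\to_A\vec v$ implies $S\vec u\to_B S\vec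 v$. A $\mathbb{Q}$-VASR abstraction is a pair $(S,V)$ with $S\in\mathbb{Q}^{d\times n}$ and $V$ a $d$-dimensional $\mathbb{Q}$-VASR; it is an abstraction of $F$ if $F\Vdash_S V$. Preorder: $(S^1,V^1)\preceq(S^2,V^2)$ (abstract dimensions $d$, $e$) iff there is $T\in\mathbb{Q}^{e\times d}$ with $V^1\Vdash_T V^2$ and $TS^1=S^2$. A best $\mathbb{Q}$-VASR abstraction of $F$ is an abstraction $(S,V)$ of $F$ with $(S,V)\preceq(\widetilde S,\widetilde V)$ for every $\mathbb{Q}$-VASR abstraction $(\widetilde S,\widetilde V)$ of $F$. For a $\mathbb{Q}$-VASR abstraction $(S,V)$ let $\gamma(S,V)\triangleq\bigvee_{(\vec r,\vec a)\in V} S\vec x'=\vec r*(S\vec x)+\vec a$. $\hat\alpha$: for a consistent conjunctive transition formula $C$ of dimension $n$, let $\mathit{Res}_C=\{(\vec s,a)\in\mathbb{Q}^n\times\mathbb{Q}: C\models \vec s\cdot\vec x'=a\}$ and $\mathit{Inc}_C=\{(\vec s,a): C\models\vec s\cdot\vec x'=\vec s\cdot\vec x+a\}$ (vector spaces). Choose a basis $(\vec s_1,a_1),\dots,(\vec s_m,a_m)$ of $\mathit{Res}_C$ and a basis $(\vec s_{m+1},a_{m+1}),\dots,(\vec s_d,a_d)$ of $\mathit{Inc}_C$, and set $\hat\alpha(C)=(S,\{(\vec r,\vec a)\})$ where $S$ has rows $\vec s_1,\dots,\vec s_d$, $\vec r=(0,\dots,0,1,\dots,1)$ ($m$ zeros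 then $d-m$ ones), $\vec a=(a_1,\dots,a_d)$. Coherence: dimensions $i,j$ of a $d$-dimensional $\mathbb{Q}$-VASR $V$ are coherent if $r_i=r_j$ for all $(\vec r,\vec a)\in V$; the equivalence classes are the coherence classes of $V$. For a coherence class $C=\{c_1<\dots<c_k\}$, $\pi_C$ is the $k\times d$ matrix with rows $\vec e_{c_1},\dots,\vec e_{c_k}$. A matrix $T\in\mathbb{Q}^{e\times d}$ is coherent w.r.t. $V$ if each row has its nonzero entries only in columns of a single coherence class. For $T$ coherent w.r.t. $V$ with no zero rows, $\mathrm{image}(V,T)=\{(T\rhd\vec r,T\vec a):(\vec r,\vec a)\in V\}$ where $(T\rhd\vec r)_i=r_j$ for any $j$ with $T_{ij}\neq0$. For matrices $A,B$ with the same number of columns, $\mathit{pushout}(A,B)$ returns $(U^1,U^2)$ whose row pairs $(U^1_i,U^2_i)$ form a basis of $\{(\vec u^1,\vec u^2):\vec u^1A=\vec u^2B\}$. Join $(S^1,V^1)\sqcup(S^2,V^2)$ (equal concrete dimension): start with empty $S,T^1,T^2$; for each coherence class $C^1$ of $V^1$ and each coherence class $C^2$ of $V^2$, let $(U^1,U^2)=\mathit{pushout}(\pi_{C^1}S^1,\pi_{C^2}S^2)$ and append the rows of $U^1\pi_{C^1}S^1$ to $S$, of $U^1\pi_{C^1}$ to $T^1$, and of $U^2\pi_{C^2}$ to $T^2$; finally let $V=\mathrm{image}(V^1,T^1)\cup\mathrm{image}(V^2,T^2)$ and return $(S,V)$. Algorithm abstract-VASR$(F)$: Skolemize the existentials of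 $F$; set $(S,V)\gets(I_n,\emptyset)$ and $\Gamma\gets F$; while $\Gamma$ is satisfiable: let $M$ be a model of $\Gamma$, let $C$ be a cube (disjunct) of the DNF of $F$ with $M\models C$, set $(S,V)\gets(S,V)\sqcup\hat\alpha(C)$ and $\Gamma\gets\Gamma\land\lnot\gamma(S,V)$; return $(S,V)$. *)

(* Defs.v *)
From Stdlib Require List.
From mathcomp Require Import all_boot all_order all_algebra.
Set Implicit Arguments. Unset Strict Implicit. Unset Printing Implicit Defensive.
Import Order.TTheory GRing.Theory Num.Theory.
Local Open Scope ring_scope.

Inductive var (n : nat) := VPre of 'I_n | VPost of 'I_n | VBnd of nat.

Inductive term (n : nat) :=
| TVar of var n
| TConst of rat
| TAdd of term n & term n
| TScale of rat & term n.

Inductive atom (n : nat) := ALt of term n & term n | AEq of term n & term n.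

Inductive lira (n : nat) :=
| FAtom of atom n
| FAnd of lira n & lira n
| FOr of lira n & lira n
| FExQ of nat & lira n
| FExZ of nat & lira n.

Arguments VBnd {n}.

Definition upd (e : nat -> rat) (k : nat) (q : rat) : nat -> rat :=
  fun j => if j == k then q else e j.

Definition eval_var n (u v : 'cV[rat]_n) (e : nat -> rat) (x : var n) : rat :=
  match x with VPre i => u i 0 | VPost i => v i 0 | VBnd k => e k end.

Fixpoint eval_term n (u v : 'cV[rat]_n) (e : nat -> rat) (t : term n) : rat :=
  match t with
  | TVar x => eval_var u v e x
  | TConst q => q
  | TAdd t1 t2 => eval_term u v e t1 + eval_term u v e t2
  | TScale q t1 => q * eval_term u v e t1
  end.

Definition holds_atom n (u v : 'cV[rat]_n) (e : nat -> rat) (a : atom n) : Prop :=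
  match a with
  | ALt s t => eval_term u v e s < eval_term u v e t
  | AEq s t => eval_term u v e s = eval_term u v e t
  end.

Fixpoint holds n (u v : 'cV[rat]_n) (e : nat -> rat) (f : lira n) : Prop :=
  match f with
  | FAtom a => holds_atom u v e a
  | FAnd f g => holds u v e f /\ holds u v e g
  | FOr f g => holds u v e f \/ holds u v e g
  | FExQ k f => exists q : rat, holds u v (upd e k q) f
  | FExZ k f => exists z : int, holds u v (upd e k z%:~R) f
  end.

Fixpoint term_closed_in n (bs : seq nat) (t : term n) : bool :=
  match t with
  | TVar (VBnd k) => k \in bs
  | TVar _ => true
  | TConst _ => true
  | TAdd t1 t2 => term_closed_in bs t1 && term_closed_in bs t2
  | TScale _ t1 => term_closed_in bs t1
  end.

Definition atom_closed_in n (bs : seq nat) (a : atom n) : bool :=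
  match a with
  | ALt s t => term_closed_in bs s && term_closed_in bs t
  | AEq s t => term_closed_in bs s && term_closed_in bs t
  end.

Fixpoint closed_in n (bs : seq nat) (f : lira n) : bool :=
  match f with
  | FAtom a => atom_closed_in bs a
  | FAnd f g => closed_in bs f && closed_in bs g
  | FOr f g => closed_in bs f && closed_in bs g
  | FExQ k f => closed_in (k :: bs) f
  | FExZ k f => closed_in (k :: bs) f
  end.

Definition is_transition_formula n (F : lira n) : Prop := closed_in [::] F.

Fixpoint is_LRA n (f : lira n) : Prop :=
  match f with
  | FAtom _ => True
  | FAnd f g | FOr f g => is_LRA f /\ is_LRA g
  | FExQ _ f => is_LRA f
  | FExZ _ _ => False
  end.

Definition trans n (F : lira n) (u v : 'cV[rat]_n) : Prop :=
  holds u v (fun _ => 0) F.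

Definition vasr (d : nat) := seq ('cV[bool]_d * 'cV[rat]_d).

Definition vmul d (r : 'cV[bool]_d) (u : 'cV[rat]_d) : 'cV[rat]_d :=
  \col_i ((nat_of_bool (r i 0))%:R * u i 0).

Definition vasr_rel d (V : vasr d) (u v : 'cV[rat]_d) : Prop :=
  exists2 ra, ra \in V & v = vmul ra.1 u + ra.2.

Definition simulates n m (RA : 'cV[rat]_n -> 'cV[rat]_n -> Prop)
  (RB : 'cV[rat]_m -> 'cV[rat]_m -> Prop) (S : 'M[rat]_(m, n)) : Prop :=
  forall u v, RA u v -> RB (S *m u) (S *m v).

Record abs (n : nat) := Abs { ad : nat; aS : 'M[rat]_(ad, n); aV : vasr ad }.

Definition is_abstraction n (F : lira n) (A : abs n) : Prop :=
  simulates (trans F) (vasr_rel (aV A)) (aS A).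

Definition preceq n (A B : abs n) : Prop :=
  exists T : 'M[rat]_(ad B, ad A),
    simulates (vasr_rel (aV A)) (vasr_rel (aV B)) T /\ T *m aS A = aS B.

Definition is_best_abstraction n (F : lira n) (A : abs n) : Prop :=
  is_abstraction F A /\ forall B : abs n, is_abstraction F B -> preceq A B.

Definition gamma n (A : abs n) (u v : 'cV[rat]_n) : Prop :=
  exists2 ra, ra \in aV A & aS A *m v = vmul ra.1 (aS A *m u) + ra.2.

Definition rename_var n (ren : nat -> nat) (x : var n) : var n :=
  match x with VBnd k => VBnd (ren k) | _ => x end.

Fixpoint rename_term n (ren : nat -> nat) (t : term n) : term n :=
  match t with
  | TVar x => TVar (rename_var ren x)
  | TConst q => TConst n q
  | TAdd t1 t2 => TAdd (rename_term ren t1) (rename_term ren t2)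
  | TScale q t1 => TScale q (rename_term ren t1)
  end.

Definition rename_atom n (ren : nat -> nat) (a : atom n) : atom n :=
  match a with
  | ALt s t => ALt (rename_term ren s) (rename_term ren t)
  | AEq s t => AEq (rename_term ren s) (rename_term ren t)
  end.

(* skol ren next f = (quantifier-free formula, next fresh name,
   names of the Skolem constants of integer sort). Every existentially
   bound variable is replaced by a fresh Skolem constant. *)
Fixpoint skol n (ren : nat -> nat) (next : nat) (f : lira n)
  : lira n * nat * seq nat :=
  match f with
  | FAtom a => (FAtom (rename_atom ren a), next, [::])
  | FAnd f g =>
      let: (f', n1, i1) := skol ren next f in
      let: (g', n2, i2) := skol ren n1 g in (FAnd f' g', n2, i1 ++ i2)
  | FOr f g =>
      let: (f', n1, i1) := skol ren next f in
      let: (g', n2, i2) := skol ren n1 g in (FOr f' g', n2, i1 ++ i2)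
  | FExQ k f => skol (fun j => if j == k then next else ren j) next.+1 f
  | FExZ k f =>
      let: (f', n1, i1) := skol (fun j => if j == k then next else ren j) next.+1 f in
      (f', n1, next :: i1)
  end.

Definition skG n (F : lira n) : lira n := (skol id 0 F).1.1.
Definition skInts n (F : lira n) : seq nat := (skol id 0 F).2.

Definition cube n := seq (atom n).

Fixpoint dnf n (f : lira n) : seq (cube n) :=
  match f with
  | FAtom a => [:: [:: a]]
  | FAnd f g => [seq c1 ++ c2 | c1 <- dnf f, c2 <- dnf g]
  | FOr f g => dnf f ++ dnf g
  | FExQ _ f | FExZ _ f => dnf f
  end.

Record model (n : nat) := Model { mpre : 'cV[rat]_n; mpost : 'cV[rat]_n; msk : nat -> rat }.

Definition model_ok n (ints : seq nat) (M : model n) : Prop :=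
  forall k, k \in ints -> exists z : int, msk M k = z%:~R.

Definition sat_cube n (M : model n) (C : cube n) : Prop :=
  forall a, List.In a C -> holds_atom (mpre M) (mpost M) (msk M) a.

Definition Res n (ints : seq nat) (C : cube n) (s : 'rV[rat]_n) (a : rat) : Prop :=
  forall M : model n, model_ok ints M -> sat_cube M C -> s *m mpost M = a%:M.

Definition Inc n (ints : seq nat) (C : cube n) (s : 'rV[rat]_n) (a : rat) : Prop :=
  forall M : model n, model_ok ints M -> sat_cube M C ->
    s *m mpost M = s *m mpre M + a%:M.

Definition is_basis n m (P : 'rV[rat]_n -> rat -> Prop)
  (B : 'M[rat]_(m, n)) (a : 'cV[rat]_m) : Prop :=
  row_free (row_mx B a) /\
  forall (s : 'rV[rat]_n) (x : rat), (row_mx s x%:M <= row_mx B a)%MS <-> P s x.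

(* A is a possible value of alpha-hat(C) (for some choice of bases) *)
Definition alpha_hat n (ints : seq nat) (C : cube n) (A : abs n) : Prop :=
  exists (m1 m2 : nat) (B1 : 'M[rat]_(m1, n)) (a1 : 'cV[rat]_m1)
         (B2 : 'M[rat]_(m2, n)) (a2 : 'cV[rat]_m2),
    is_basis (Res ints C) B1 a1 /\ is_basis (Inc ints C) B2 a2 /\
    A = Abs (col_mx B1 B2) [:: (col_mx (const_mx false) (const_mx true), col_mx a1 a2)].

Definition coherent d (V : vasr d) (i j : 'I_d) : bool :=
  all (fun ra : 'cV[bool]_d * 'cV[rat]_d => ra.1 i 0 == ra.1 j 0) V.

Definition coh_class d (V : vasr d) (i : 'I_d) : {set 'I_d} := [set j | coherent V i j].

Definition coh_classes d (V : vasr d) : {set {set 'I_d}} :=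
  [set coh_class V i | i : 'I_d].

Definition enumerates (T : eqType) (cs : seq T) (P : T -> bool) : Prop :=
  uniq cs /\ forall C, (C \in cs) = P C.

Definition pi_mx d (C : {set 'I_d}) : 'M[rat]_(#|C|, d) :=
  \matrix_(i < #|C|, j < d) ((nth j (enum C) i == j)%:R).

Definition is_pushout n k1 k2 p (A : 'M[rat]_(k1, n)) (B : 'M[rat]_(k2, n))
  (U1 : 'M[rat]_(p, k1)) (U2 : 'M[rat]_(p, k2)) : Prop :=
  row_free (row_mx U1 U2) /\
  forall (u1 : 'rV[rat]_k1) (u2 : 'rV[rat]_k2),
    (row_mx u1 u2 <= row_mx U1 U2)%MS <-> u1 *m A = u2 *m B.

Definition tri d e (T : 'M[rat]_(e, d)) (r : 'cV[bool]_d) : 'cV[bool]_e :=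
  \col_i (match [pick j | T i j != 0] with Some j => r j 0 | None => false end).

Definition image d e (V : vasr d) (T : 'M[rat]_(e, d)) : vasr e :=
  [seq (tri T ra.1, T *m ra.2) | ra <- V].

Definition block3 n d1 d2 :=
  {k : nat & ('M[rat]_(k, n) * 'M[rat]_(k, d1) * 'M[rat]_(k, d2))%type}.

Definition app3 n d1 d2 (b acc : block3 n d1 d2) : block3 n d1 d2 :=
  let: existT p (X, Y, Z) := b in
  let: existT q (X', Y', Z') := acc in
  existT _ (p + q) (col_mx X X', col_mx Y Y', col_mx Z Z').

Definition empty3 n d1 d2 : block3 n d1 d2 :=
  existT _ 0%N (0, 0, 0).

Definition pushout_choice d1 d2 :=
  forall (C1 : {set 'I_d1}) (C2 : {set 'I_d2}),
    {p : nat & ('M[rat]_(p, #|C1|) * 'M[rat]_(p, #|C2|))%type}.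

Definition join_fun n (A1 A2 : abs n)
  (cs1 : seq {set 'I_(ad A1)}) (cs2 : seq {set 'I_(ad A2)})
  (po : pushout_choice (ad A1) (ad A2)) : abs n :=
  let blk (C1 : {set 'I_(ad A1)}) (C2 : {set 'I_(ad A2)}) : block3 n (ad A1) (ad A2) :=
    let: existT p (U1, U2) := po C1 C2 in
    existT _ p (U1 *m pi_mx C1 *m aS A1, U1 *m pi_mx C1, U2 *m pi_mx C2) in
  let acc := foldr (@app3 n _ _) (@empty3 n _ _) [seq blk C1 C2 | C1 <- cs1, C2 <- cs2] in
  let: existT k (SS, T1, T2) := acc in
  Abs SS (image (aV A1) T1 ++ image (aV A2) T2).

(* B is a possible value of A1 ⊔ A2 (for some order of the coherence
   classes and some choice of pushout bases) *)
Definition join_rel n (A1 A2 B : abs n) : Prop :=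
  exists (cs1 : seq {set 'I_(ad A1)}) (cs2 : seq {set 'I_(ad A2)})
         (po : pushout_choice (ad A1) (ad A2)),
    enumerates cs1 (fun C => C \in coh_classes (aV A1)) /\
    enumerates cs2 (fun C => C \in coh_classes (aV A2)) /\
    (forall C1 C2, is_pushout (pi_mx C1 *m aS A1) (pi_mx C2 *m aS A2)
                     (projT2 (po C1 C2)).1 (projT2 (po C1 C2)).2) /\
    B = join_fun cs1 cs2 po.

(* state: current abstraction (S, V) and current formula Γ (semantically,
   as a predicate on models of the Skolemized vocabulary) *)
Record alg_state (n : nat) := AState { st_abs : abs n; st_gamma : model n -> Prop }.

Definition init_state n (F : lira n) : alg_state n :=
  AState (Abs (1%:M : 'M[rat]_(n, n)) [::])
         (fun M => holds (mpre M) (mpost M) (msk M) (skG F)).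

Definition gamma_sat n (F : lira n) (s : alg_state n) : Prop :=
  exists M, model_ok (skInts F) M /\ st_gamma s M.

Inductive alg_step n (F : lira n) : alg_state n -> alg_state n -> Prop :=
| AlgStep (A : abs n) (G : model n -> Prop) (M : model n) (C : cube n) (A' B : abs n) :
    model_ok (skInts F) M -> G M ->
    List.In C (dnf (skG F)) -> sat_cube M C ->
    alpha_hat (skInts F) C A' -> join_rel A A' B ->
    alg_step F (AState A G)
      (AState B (fun M' => G M' /\ ~ gamma B (mpre M') (mpost M'))).

Inductive alg_reach n (F : lira n) : alg_state n -> alg_state n -> Prop :=
| reach_refl s : alg_reach F s s
| reach_step s t u : alg_step F s t -> alg_reach F t u -> alg_reach F s u.

(* Main.v *)
(* A convex set covered by finitely many affine subspaces of Q^n lies in one of them.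
   Applied to a cube over LRA, this makes one transformer of any abstraction of F
   simulate the whole cube, so alpha-hat of the cube is below that abstraction. Applied
   to Q^d, it forces every simulation between Q-VASRs to be coherent, one target
   transformer answering each source transformer uniformly; hence each row of a pair of
   simulations into a common upper bound factors through the pushout of two coherence
   classes, and the join is a least upper bound. The latter needs the concrete rows of
   each coherence class to be linearly independent, which alpha-hat of a consistent cube
   satisfies and the join preserves. Termination: after its iteration, a cube of the DNF
   is covered by gamma, hence never chosen again. *)
From Stdlib Require List.
From Stdlib Require Import Classical.
Require Import Defs.
From mathcomp Require Import all_boot all_order all_algebra.
From mathcomp Require Import zify ring lra.
Set Implicit Arguments. Unset Strict Implicit. Unset Printing Implicit Defensive.
Import Order.TTheory GRing.Theory Num.Theory.
Local Open Scope ring_scope.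

(** * Convex sets covered by finitely many affine subspaces *)

(** Each index forbids at most one parameter, which cannot lie in both outer closed thirds of the
    interval; the induction continues in a third that misses it. *)
Lemma avoid_singletons (I : eqType) (P : I -> rat -> Prop) (s : seq I) (a b : rat) :
  a < b ->
  (forall i x y, i \in s -> P i x -> P i y -> x = y) ->
  exists2 t, a <= t <= b & forall i, i \in s -> ~ P i t.
Proof.
elim: s a b => [|i s IH] a b ab Ps; first by exists a => //; lra.
have Ps' : forall j x y, j \in s -> P j x -> P j y -> x = y.
  by move=> j x y js; apply: Ps; rewrite inE js orbT.
case: (classic (exists2 x, a <= x <= (2 * a + b) / 3 & P i x)) => [[x xab Px]|nP].
- have [||t tab nPt] := IH ((a + 2 * b) / 3) b; [lra | exact: Ps' |].
  exists t; first by lra.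
  move=> j; rewrite inE => /orP[/eqP->|]; last exact: nPt.
  move=> Pt; have xt : x = t by apply: (Ps i) => //; rewrite mem_head.
  lra.
- have [||t tab nPt] := IH a ((2 * a + b) / 3); [lra | exact: Ps' |].
  exists t; first by lra.
  move=> j; rewrite inE => /orP[/eqP->|]; last exact: nPt.
  by move=> Pt; apply: nP; exists t.
Qed.

Section AffineCover.
Variables (X : Type) (W : lmodType rat) (I : eqType).
Variables (comb : rat -> X -> X -> X) (f : I -> X -> W) (K : X -> Prop).
Hypothesis f_affine : forall i t x y,
  f i (comb t x y) = (1 - t) *: f i x + t *: f i y.
Hypothesis K_convex : forall t x y, 0 <= t <= 1 -> K x -> K y -> K (comb t x y).

(** Along the line through [x] and [y], [f i] is affine in the parameter, so two distinct zeros make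
    it vanish identically. *)
Lemma affine_two_zeros i x y s t : s != t ->
  f i (comb s x y) = 0 -> f i (comb t x y) = 0 -> f i x = 0 /\ f i y = 0.
Proof.
rewrite !f_affine => st fs ft.
have ts0 : t - s != 0 by rewrite subr_eq0 eq_sym.
have E1 : (t - s) *: f i x = t *: ((1 - s) *: f i x + s *: f i y)
                           - s *: ((1 - t) *: f i x + t *: f i y).
  rewrite !scalerDr !scalerA opprD addrACA [s * t]mulrC subrr addr0 -scalerBl.
  by congr (_ *: _); ring.
rewrite fs ft !scaler0 subr0 in E1.
have fx : f i x = 0 by move/eqP: E1; rewrite scaler_eq0 (negbTE ts0) => /eqP.
split=> //; move: fs ft; rewrite fx !scaler0 !add0r => /eqP.
rewrite scaler_eq0 => /orP[/eqP s0|/eqP //] /eqP.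
by rewrite scaler_eq0 => /orP[/eqP t0|/eqP //]; rewrite s0 t0 eqxx in st.
Qed.

Lemma affine_cover (s : seq I) (x0 : X) : K x0 ->
  (forall x, K x -> exists2 i, i \in s & f i x = 0) ->
  exists2 i, i \in s & forall x, K x -> f i x = 0.
Proof.
move=> Kx0; elim: s => [|i s IH] cov; first by have [] := cov _ Kx0.
case: (classic (forall x, K x -> exists2 j, j \in s & f j x = 0)) => [|ncov].
  by move=> /IH[j js fj]; exists j => //; rewrite inE js orbT.
exists i; first exact: mem_head.
(* Here [x] escapes all pieces of [s] and [y] escapes piece [i]. Hence each piece meets the segment
   from [x] to [y] in at most one point, and some point of the segment avoids all of them. *)
move=> y Ky; apply: NNPP => fy; apply: ncov => x Kx.
apply: NNPP => fx.
have [||t t01 nt] :=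
  @avoid_singletons I (fun j t => f j (comb t x y) = 0) (i :: s) 0 1.
- by [].
- move=> j a b; rewrite inE => ijs fa fb; apply/eqP; apply: contraT => ab.
  have [fjx fjy] := affine_two_zeros ab fa fb.
  by case/orP: ijs => [/eqP ji|js]; [case: fy; rewrite -ji | case: fx; exists j].
- have [j js fj] := cov _ (K_convex t01 Kx Ky).
  by case: (nt j js).
Qed.
End AffineCover.

(** * Coherence and simulations *)

Definition coherent_row d (V : vasr d) (u : 'rV[rat]_d) :=
  forall i j, u 0 i != 0 -> u 0 j != 0 -> coherent V i j.

Definition supported d (u : 'rV[rat]_d) (C : {set 'I_d}) :=
  forall j, u 0 j != 0 -> j \in C.

Definition coherent_mx d e (V : vasr d) (T : 'M[rat]_(e, d)) :=
  forall k, coherent_row V (row k T).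

(* Without normality, rows of a join may vanish in one component, where [tri]
   returns the junk value [false], and the join is no longer a least upper bound. *)
Definition normal n (A : abs n) :=
  forall u, coherent_row (aV A) u -> u *m aS A = 0 -> u = 0.

Lemma coherentP d (V : vasr d) i j :
  reflect (forall ra, ra \in V -> ra.1 i 0 = ra.1 j 0) (coherent V i j).
Proof.
by apply: (iffP allP) => H ra raV; apply/eqP; [exact: H | rewrite H].
Qed.

Lemma coherent_sym d (V : vasr d) i j : coherent V i j = coherent V j i.
Proof. by apply/coherentP/coherentP => H ra raV; rewrite H. Qed.

Lemma coherent_trans d (V : vasr d) i j k :
  coherent V i j -> coherent V j k -> coherent V i k.
Proof. by move=> /coherentP ij /coherentP jk; apply/coherentP => ra raV; rewrite ij ?jk. Qed.

Lemma coh_classes_coherent d (V : vasr d) C i j :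
  C \in coh_classes V -> i \in C -> j \in C -> coherent V i j.
Proof.
case/imsetP=> k _ ->; rewrite !inE => ki; apply: coherent_trans.
by rewrite coherent_sym.
Qed.

Lemma supported_coherent d (V : vasr d) (u : 'rV_d) C :
  C \in coh_classes V -> supported u C -> coherent_row V u.
Proof. by move=> CV uC i j /uC iC /uC jC; exact: coh_classes_coherent CV iC jC. Qed.

Lemma coh_classes_eq d (V : vasr d) C D i j :
  C \in coh_classes V -> D \in coh_classes V -> i \in C -> j \in D ->
  coherent V i j -> C = D.
Proof.
case/imsetP=> k _ -> /imsetP[l _ ->]; rewrite !inE => ki lj ij.
have kl : coherent V k l.
  by apply: coherent_trans ki (coherent_trans ij _); rewrite coherent_sym.
apply/setP => x; rewrite !inE; apply/idP/idP; apply: coherent_trans => //.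
by rewrite coherent_sym.
Qed.

Lemma rV_neq0P d (u : 'rV[rat]_d) : u != 0 -> exists i, u 0 i != 0.
Proof.
move=> u0; apply/existsP; apply: contraR u0 => /existsPn H.
by apply/eqP/rowP => i; rewrite mxE; apply/eqP; rewrite -[_ == _]negbK H.
Qed.

Lemma coherent_row_class d (V : vasr d) (u : 'rV[rat]_d) :
  coherent_row V u -> u != 0 ->
  exists2 C, C \in coh_classes V & supported u C.
Proof.
move=> cu /rV_neq0P[i ui]; exists (coh_class V i); first exact: imset_f.
by move=> j uj; rewrite inE; exact: cu.
Qed.

Lemma tri_coherent d e (V : vasr d) (T : 'M[rat]_(e, d)) ra k j :
  coherent_mx V T -> ra \in V -> T k j != 0 -> tri T ra.1 k 0 = ra.1 j 0.
Proof.
move=> cT raV Tkj; rewrite mxE; case: pickP => [l Tkl|/(_ j)]; last by rewrite Tkj.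
by have /coherentP -> // : coherent V l j by apply: (cT k); rewrite mxE.
Qed.

Lemma mulmx_vmul d e (V : vasr d) (T : 'M[rat]_(e, d)) ra (w : 'cV[rat]_d) :
  coherent_mx V T -> ra \in V ->
  T *m vmul ra.1 w = vmul (tri T ra.1) (T *m w).
Proof.
move=> cT raV; apply/colP => k; rewrite [LHS]mxE [RHS]mxE [(T *m w) _ _]mxE mulr_sumr.
apply: eq_bigr => j _; rewrite [vmul _ _ _ _]mxE.
have [->|Tkj] := eqVneq (T k j) 0; first by rewrite !mul0r mulr0.
by rewrite (tri_coherent cT raV Tkj); ring.
Qed.

Lemma gamma_image n (A : abs n) e (T : 'M[rat]_(e, ad A)) (V : vasr e) u v :
  coherent_mx (aV A) T -> {subset Defs.image (aV A) T <= V} ->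
  gamma A u v -> gamma (Abs (T *m aS A) V) u v.
Proof.
move=> cT sub [ra raV E]; exists (tri T ra.1, T *m ra.2).
  by apply: sub; apply/mapP; exists ra.
by rewrite /= -!mulmxA E mulmxDr (mulmx_vmul _ cT raV).
Qed.

Lemma vmulD d r (u v : 'cV[rat]_d) : vmul r (u + v) = vmul r u + vmul r v.
Proof. by apply/colP => i; rewrite !mxE mulrDr. Qed.

Lemma vmulZ d r c (u : 'cV[rat]_d) : vmul r (c *: u) = c *: vmul r u.
Proof. by apply/colP => i; rewrite !mxE mulrCA. Qed.

Lemma vmul0 d r : vmul r (0 : 'cV[rat]_d) = 0.
Proof. by apply/colP => i; rewrite !mxE mulr0. Qed.

(** For a fixed source transformer, the points answered by a given target transformer form an affine
    subspace. These cover the whole space, so one target transformer answers everywhere. Its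
    equation at 0 compares the offsets, and at unit vectors the reset bits. *)
Lemma simulatesP d e (V : vasr d) (W : vasr e) (T : 'M[rat]_(e, d)) :
  simulates (vasr_rel V) (vasr_rel W) T <->
  forall ra, ra \in V -> exists2 sb, sb \in W &
    T *m ra.2 = sb.2 /\ forall i j, T i j != 0 -> ra.1 j 0 = sb.1 i 0.
Proof.
split=> [sim ra raV|H u _ [ra raV ->]].
- pose f (sb : 'cV[bool]_e * 'cV[rat]_e) (u : 'cV[rat]_d) :=
    T *m (vmul ra.1 u + ra.2) - (vmul sb.1 (T *m u) + sb.2).
  have [||||sb sbW fsb] := @affine_cover 'cV[rat]_d 'cV[rat]_e _
    (fun t x y => (1 - t) *: x + t *: y) f (fun _ => True) _ _ W 0.
  + move=> sb t x y; rewrite /f !(mulmxDr, vmulD, =^~ scalemxAr, vmulZ).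
    move: (T *m vmul _ x) (T *m vmul _ y) (vmul _ (_ *m x)) (vmul _ (_ *m y)) (T *m _) => a b c a' b'.
    by apply/colP => i; rewrite !mxE; ring.
  + by [].
  + by [].
  + move=> u _; have [|sb sbW E] := sim u (vmul ra.1 u + ra.2); first by exists ra.
    by exists sb => //; rewrite /f E subrr.
  exists sb => //.
  have a0 : T *m ra.2 = sb.2.
    have := fsb 0 I; rewrite /f mulmx0.
    by rewrite !vmul0 !add0r => /eqP; rewrite subr_eq0 => /eqP.
  split=> // i j Tij; have := fsb (delta_mx j 0) I.
  rewrite /f mulmxDr a0 opprD addrACA subrr addr0 => /colP/(_ i).
  have -> : vmul ra.1 (delta_mx j 0) = (nat_of_bool (ra.1 j 0))%:R *: delta_mx j 0.
    by apply/colP => l; rewrite !mxE; have [->|] := eqVneq l j; rewrite /= ?mulr0.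
  rewrite -scalemxAr -colE !mxE => /eqP; rewrite -mulrBl mulf_eq0 (negbTE Tij) orbF.
  by case: (ra.1 j 0) (sb.1 i 0) => [] [].
have [sb sbW [a0 rs]] := H _ raV; exists sb => //.
rewrite mulmxDr a0; congr (_ + _); apply/colP => i.
rewrite [LHS]mxE [RHS]mxE [(T *m u) _ _]mxE mulr_sumr; apply: eq_bigr => j _.
rewrite [vmul _ _ _ _]mxE.
have [->|Tij] := eqVneq (T i j) 0; first by rewrite !mul0r mulr0.
by rewrite (rs i j Tij); ring.
Qed.

(** [tri] reads the bit of dimension [k] from some column [j] of [T]; the last hypothesis ties it to
    a column [j'] where the simulation [R] already fixes the bit. *)
Lemma simulates_image d e m (V : vasr d) (W : vasr m) (T : 'M_(e, d)) (R : 'M_(m, d))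
    (Q : 'M_(m, e)) :
  coherent_mx V T -> Q *m T = R -> simulates (vasr_rel V) (vasr_rel W) R ->
  (forall i k, Q i k != 0 ->
     exists j j', [/\ T k j != 0, R i j' != 0 & coherent V j j']) ->
  simulates (vasr_rel (Defs.image V T)) (vasr_rel W) Q.
Proof.
move=> coT QT /simulatesP sR H; apply/simulatesP => _ /mapP[ra raV ->] /=.
have [sb sbW [E rs]] := sR _ raV; exists sb => //; split; first by rewrite mulmxA QT.
move=> i k /H[j [j' [Tj Rj co]]]; rewrite (tri_coherent coT raV Tj) -(rs i j' Rj).
by have /coherentP -> := co.
Qed.

Lemma simulates_cat d e (V V' : vasr d) (W : vasr e) T :
  simulates (vasr_rel V) (vasr_rel W) T -> simulates (vasr_rel V') (vasr_rel W) T ->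
  simulates (vasr_rel (V ++ V')) (vasr_rel W) T.
Proof.
move=> s s' u v [ra]; rewrite mem_cat => /orP[] raV E; [apply: s | apply: s'];
by exists ra.
Qed.

Lemma simulates_coherent d e (V : vasr d) (W : vasr e) T :
  simulates (vasr_rel V) (vasr_rel W) T -> coherent_mx V T.
Proof.
move=> /simulatesP sT k i j; rewrite !mxE => Ti Tj; apply/coherentP => ra /sT[sb _ [_ H]].
by rewrite (H k i) ?(H k j).
Qed.

(** * The join *)

Lemma mul_pi_mx d k (C : {set 'I_d}) (M : 'M[rat]_(k, #|C|)) i j :
  (M *m pi_mx C) i j = \sum_l M i l * (enum_val l == j)%:R.
Proof.
rewrite mxE; apply: eq_bigr => l _; rewrite mxE; congr (_ * (_ == _)%:R).
by rewrite /enum_val; apply: set_nth_default; rewrite -cardE.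
Qed.

Lemma mul_pi_mx_enum d k (C : {set 'I_d}) (M : 'M[rat]_(k, #|C|)) i l :
  (M *m pi_mx C) i (enum_val l) = M i l.
Proof.
rewrite mul_pi_mx (bigD1 l) //= eqxx mulr1 big1 ?addr0 // => l' ll'.
by rewrite (inj_eq enum_val_inj) (negbTE ll') mulr0.
Qed.

Lemma mul_pi_mx_notin d k (C : {set 'I_d}) (M : 'M[rat]_(k, #|C|)) i j :
  j \notin C -> (M *m pi_mx C) i j = 0.
Proof.
move=> jC; rewrite mul_pi_mx big1 // => l _.
by case: eqP => [E|_]; [rewrite -E enum_valP in jC | rewrite mulr0].
Qed.

Lemma supported_pi d (C : {set 'I_d}) k (M : 'M[rat]_(k, #|C|)) i :
  supported (row i (M *m pi_mx C)) C.
Proof.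
by move=> j; rewrite mxE; apply: contraR => jC; rewrite mul_pi_mx_notin.
Qed.

Lemma supportedP d (u : 'rV[rat]_d) (C : {set 'I_d}) :
  supported u C -> exists w : 'rV_#|C|, u = w *m pi_mx C.
Proof.
move=> uC; exists (\row_l u 0 (enum_val l)); apply/rowP => j.
have [jC|jC] := boolP (j \in C).
  by rewrite -(enum_rankK_in jC jC) mul_pi_mx_enum mxE.
rewrite mul_pi_mx_notin //; apply/eqP; apply: contraR jC; exact: uC.
Qed.

Lemma mul_pi_mx_inj d (C : {set 'I_d}) k : injective (fun M : 'M_(k, #|C|) => M *m pi_mx C).
Proof.
by move=> M N /= MN; apply/matrixP => i l; rewrite -mul_pi_mx_enum MN mul_pi_mx_enum.
Qed.

Section JoinBlocks.
Variables (n d1 d2 : nat) (S1 : 'M[rat]_(d1, n)) (S2 : 'M[rat]_(d2, n)).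
Local Notation label := ({set 'I_d1} * {set 'I_d2})%type.

(* [lab k] is the pair of coherence classes whose pushout produced row [k] *)
Record blocks_spec (cs : seq label) k (X : 'M[rat]_(k, n)) (T1 : 'M[rat]_(k, d1))
    (T2 : 'M[rat]_(k, d2)) (lab : 'I_k -> label) : Prop := BlocksSpec {
  blk_lab : forall i, lab i \in cs;
  blk_sup1 : forall i, supported (row i T1) (lab i).1;
  blk_sup2 : forall i, supported (row i T2) (lab i).2;
  blk_X1 : X = T1 *m S1;
  blk_X2 : X = T2 *m S2;
  blk_onto : forall p u1 u2, p \in cs -> supported u1 p.1 -> supported u2 p.2 ->
    u1 *m S1 = u2 *m S2 ->
    exists w : 'rV_k, [/\ forall i, w 0 i != 0 -> lab i = p, w *m T1 = u1 & w *m T2 = u2];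
  blk_free : forall p (w : 'rV_k), (forall i, w 0 i != 0 -> lab i = p) ->
    w *m T1 = 0 -> w *m T2 = 0 -> w = 0 }.

(** The spanning half of [is_pushout] yields [blk_X2] and [blk_onto]; the freeness half yields
    [blk_free], since multiplication by [pi_mx] is injective. *)
Lemma pushout_blocks (p : label) m (U1 : 'M[rat]_(m, #|p.1|)) (U2 : 'M[rat]_(m, #|p.2|)) :
  is_pushout (pi_mx p.1 *m S1) (pi_mx p.2 *m S2) U1 U2 ->
  blocks_spec [:: p] (U1 *m pi_mx p.1 *m S1) (U1 *m pi_mx p.1) (U2 *m pi_mx p.2)
    (fun _ => p).
Proof.
move=> [fU spanU]; split=> [i|i|i||||].
- exact: mem_head.
- exact: supported_pi.
- exact: supported_pi.
- by [].
- apply/row_matrixP => i; rewrite -!mulmxA !row_mul; apply/spanU.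
  by rewrite -row_row_mx; exact: row_sub.
- move=> q u1 u2; rewrite inE => /eqP-> /supportedP[w1 ->] /supportedP[w2 ->].
  rewrite -!mulmxA => /spanU/submxP[w]; rewrite mul_mx_row => /eq_row_mx[-> ->].
  by exists w; rewrite !mulmxA.
- move=> q w _; rewrite !mulmxA => E1 E2; apply: (row_free_inj fU).
  have w1 : w *m U1 = 0 by apply: mul_pi_mx_inj; rewrite /= E1 mul0mx.
  have w2 : w *m U2 = 0 by apply: mul_pi_mx_inj; rewrite /= E2 mul0mx.
  by rewrite mul_mx_row w1 w2 row_mx0 mul0mx.
Qed.

Lemma nil_blocks : blocks_spec [::] 0 0 0 (fun i : 'I_0 => (set0, set0)).
Proof.
split=> //; try by case.
- by rewrite mul0mx.
- by rewrite mul0mx.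
- by move=> p w _ _ _; exact: thinmx0.
Qed.

(** For [blk_free], a vector supported on rows of label [p] lives in one of the two blocks, because
    [p] labels rows of at most one of them. *)
Lemma cat_blocks cs1 cs2 k1 (X : 'M_(k1, n)) Y Z lab k2 (X' : 'M_(k2, n)) Y' Z' lab' :
  (forall p, p \in cs1 -> p \notin cs2) ->
  blocks_spec cs1 X Y Z lab -> blocks_spec cs2 X' Y' Z' lab' ->
  blocks_spec (cs1 ++ cs2) (col_mx X X') (col_mx Y Y') (col_mx Z Z')
    (fun i => match split i with inl j => lab j | inr j => lab' j end).
Proof.
move=> dis b1 b2; split=> [i|i|i||||].
- by case: splitP => j _; rewrite mem_cat ?(blk_lab b1) ?(blk_lab b2) ?orbT.
- move=> j; rewrite mxE mxE; case: (split i) => l.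
    by have := @blk_sup1 _ _ _ _ _ _ b1 l j; rewrite mxE.
  by have := @blk_sup1 _ _ _ _ _ _ b2 l j; rewrite mxE.
- move=> j; rewrite mxE mxE; case: (split i) => l.
    by have := @blk_sup2 _ _ _ _ _ _ b1 l j; rewrite mxE.
  by have := @blk_sup2 _ _ _ _ _ _ b2 l j; rewrite mxE.
- by rewrite mul_col_mx -(blk_X1 b1) -(blk_X1 b2).
- by rewrite mul_col_mx -(blk_X2 b1) -(blk_X2 b2).
- move=> p u1 u2; rewrite mem_cat => /orP[] pcs s1 s2 E.
    have [w [wl w1 w2]] := blk_onto b1 pcs s1 s2 E.
    exists (row_mx w 0); rewrite !mul_row_col !mul0mx !addr0; split=> // i.
    by rewrite mxE; case: (split i) => j; [exact: wl | rewrite mxE eqxx].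
  have [w [wl w1 w2]] := blk_onto b2 pcs s1 s2 E.
  exists (row_mx 0 w); rewrite !mul_row_col !mul0mx !add0r; split=> // i.
  by rewrite mxE; case: (split i) => j; [rewrite mxE eqxx | exact: wl].
- move=> p w; rewrite -[w]hsubmxK; set w1 := lsubmx w; set w2 := rsubmx w.
  move=> wl; rewrite !mul_row_col => Y0 Z0.
  have l1 i : w1 0 i != 0 -> lab i = p.
    by move=> wi; have := wl (lshift _ i); rewrite row_mxEl (unsplitK (inl i)); apply.
  have l2 i : w2 0 i != 0 -> lab' i = p.
    by move=> wi; have := wl (rshift _ i); rewrite row_mxEr (unsplitK (inr i)); apply.
  have [pcs|pcs] := boolP (p \in cs1).
  + have w20 : w2 = 0.
      apply/eqP; apply: contraT => /rV_neq0P[i /l2 li].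
      by have := dis p pcs; rewrite -li (blk_lab b2).
    move: Y0 Z0; rewrite w20 !mul0mx !addr0 => Y0 Z0.
    by rewrite (blk_free b1 l1 Y0 Z0) row_mx0.
  + have w10 : w1 = 0.
      apply/eqP; apply: contraT => /rV_neq0P[i /l1 li].
      by move: pcs; rewrite -li (blk_lab b1).
    move: Y0 Z0; rewrite w10 !mul0mx !add0r => Y0 Z0.
    by rewrite (blk_free b2 l2 Y0 Z0) row_mx0.
Qed.

Lemma foldr_blocks (blk : label -> block3 n d1 d2) (cs : seq label) :
  uniq cs ->
  (forall p, exists lab, blocks_spec [:: p] (projT2 (blk p)).1.1 (projT2 (blk p)).1.2
                                    (projT2 (blk p)).2 lab) ->
  let acc := foldr (@app3 n d1 d2) (@empty3 n d1 d2) [seq blk p | p <- cs] in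
  exists lab, blocks_spec cs (projT2 acc).1.1 (projT2 acc).1.2 (projT2 acc).2 lab.
Proof.
move=> ucs hb /=; elim: cs ucs => [_|p cs IH /= /andP[pcs ucs]].
  by exists (fun _ => (set0, set0)); exact: nil_blocks.
have [lab' H'] := IH ucs; have [lab H] := hb p; move: lab lab' H H'.
case: (blk p) => k1 [[X Y] Z]; case: (foldr _ _ _) => k2 [[X' Y'] Z'] /= lab lab' H H'.
eexists; apply: (cat_blocks (cs1 := [:: p])) H H' => q; by rewrite inE => /eqP->.
Qed.
End JoinBlocks.

Definition class_pairs d1 d2 (V1 : vasr d1) (V2 : vasr d2) (p : {set 'I_d1} * {set 'I_d2}) :=
  (p.1 \in coh_classes V1) && (p.2 \in coh_classes V2).

(** Hides the order of the classes and the choice of pushout bases behind [blocks_spec]. *)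
Lemma join_relP n (A1 A2 B : abs n) : join_rel A1 A2 B ->
  exists k (X : 'M[rat]_(k, n)) T1 T2 cs lab,
    [/\ cs =i class_pairs (aV A1) (aV A2),
        blocks_spec (aS A1) (aS A2) cs X T1 T2 lab &
        B = Abs X (Defs.image (aV A1) T1 ++ Defs.image (aV A2) T2)].
Proof.
move=> [cs1 [cs2 [po [[u1 e1] [[u2 e2] [hpo ->]]]]]].
pose blk p : block3 n (ad A1) (ad A2) :=
  let: existT m (U1, U2) := po p.1 p.2 in
  existT _ m (U1 *m pi_mx p.1 *m aS A1, U1 *m pi_mx p.1, U2 *m pi_mx p.2).
pose cs := [seq (C1, C2) | C1 <- cs1, C2 <- cs2].
have ucs : uniq cs by apply: allpairs_uniq => // [[? ?]] [? ?].
have [|lab H] := @foldr_blocks n _ _ (aS A1) (aS A2) blk cs ucs.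
  move=> p; exists (fun _ => p); have := hpo p.1 p.2; rewrite /blk.
  by case: (po p.1 p.2) => m [U1 U2] /=; exact: pushout_blocks.
rewrite /join_fun.
have -> : [seq (let: existT m (U1, U2) := po C1 C2 in
           existT (fun k => ('M[rat]_(k, n) * 'M[rat]_(k, ad A1) * 'M[rat]_(k, ad A2))%type)
           m (U1 *m pi_mx C1 *m aS A1, U1 *m pi_mx C1, U2 *m pi_mx C2)) | C1 <- cs1, C2 <- cs2]
   = [seq blk p | p <- cs] by rewrite map_allpairs.
move: lab H; case: (foldr _ _ _) => k [[X T1] T2] /= lab H.
exists k, X, T1, T2, cs, lab; split=> // p.
apply/allpairsP/andP => [[q [q1 q2 ->]]|[p1 p2]] /=; first by rewrite -e1 -e2.
by exists p; rewrite e1 e2; case: p p1 p2.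
Qed.

Lemma join_exists n (A1 A2 : abs n) : exists B, join_rel A1 A2 B.
Proof.
(* A pair [(u1, u2)] lies in this kernel exactly when its two images agree, so a row basis of the
   kernel, cut in two, is a pushout. *)
pose K C1 C2 := kermx (col_mx (pi_mx C1 *m aS A1) (- (pi_mx C2 *m aS A2))).
pose po : pushout_choice (ad A1) (ad A2) := fun C1 C2 =>
  existT _ _ (lsubmx (row_base (K C1 C2)), rsubmx (row_base (K C1 C2))).
eexists; exists (enum (coh_classes (aV A1))), (enum (coh_classes (aV A2))), po.
split; first by split; [exact: enum_uniq | move=> C; rewrite mem_enum].
split; first by split; [exact: enum_uniq | move=> C; rewrite mem_enum].
split; last by [].
move=> C1 C2; rewrite /is_pushout /= hsubmxK; split; first exact: row_base_free.
move=> u1 u2; rewrite eq_row_base; split=> [/sub_kermxP|E]; last apply/sub_kermxP.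
  by rewrite mul_row_col mulmxN => /eqP; rewrite subr_eq0 => /eqP.
by rewrite mul_row_col mulmxN E subrr.
Qed.

Section JoinFacts.
Variables (n : nat) (A1 A2 B : abs n).
Hypothesis joinB : join_rel A1 A2 B.

Lemma gamma_joinl u v : gamma A1 u v -> gamma B u v.
Proof.
have [k [X [T1 [T2 [cs [lab [csE bl ->]]]]]]] := join_relP joinB.
rewrite (blk_X1 bl); apply: gamma_image; last by move=> x xV; rewrite mem_cat xV.
move=> i; have := blk_lab bl i; rewrite csE => /andP[c1 _].
by apply: supported_coherent c1 _; apply: (blk_sup1 bl).
Qed.

Lemma gamma_joinr u v : gamma A2 u v -> gamma B u v.
Proof.
have [k [X [T1 [T2 [cs [lab [csE bl ->]]]]]]] := join_relP joinB.
rewrite (blk_X2 bl); apply: gamma_image; last by move=> x xV; rewrite mem_cat xV orbT.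
move=> i; have := blk_lab bl i; rewrite csE => /andP[_ c2].
by apply: supported_coherent c2 _; apply: (blk_sup2 bl).
Qed.

Hypotheses (norm1 : normal A1) (norm2 : normal A2).

(** If one of the two rows vanished, so would the row of [X], hence by normality the other one; the
    unit vector at [i] would then contradict [blk_free]. *)
Lemma row_neq0_joined k (X : 'M_(k, n)) T1 T2 cs lab i :
  cs =i class_pairs (aV A1) (aV A2) ->
  blocks_spec (aS A1) (aS A2) cs X T1 T2 lab ->
  (exists j, T1 i j != 0) /\ (exists j, T2 i j != 0).
Proof.
move=> csE bl; have /andP[c1 c2] : class_pairs (aV A1) (aV A2) (lab i).
  by rewrite -[class_pairs _ _ _]csE (blk_lab bl).
have co1 : coherent_row (aV A1) (row i T1).
  by apply: supported_coherent c1 _; apply: (blk_sup1 bl).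
have co2 : coherent_row (aV A2) (row i T2).
  by apply: supported_coherent c2 _; apply: (blk_sup2 bl).
have z : row i T1 = 0 <-> row i T2 = 0.
  split=> z; [apply: norm2 co2 _ | apply: norm1 co1 _].
    by rewrite -row_mul -(blk_X2 bl) (blk_X1 bl) row_mul z mul0mx.
  by rewrite -row_mul -(blk_X1 bl) (blk_X2 bl) row_mul z mul0mx.
have nz : row i T1 != 0.
  apply/eqP => z1; have := blk_free bl (p := lab i) (w := delta_mx 0 i).
  rewrite -!rowE z1 (proj1 z z1) => H.
  have/rowP/(_ i) : delta_mx 0 i = 0 :> 'rV[rat]_k.
    apply: H => // j; by rewrite mxE; case: (eqVneq j i) => [->|] //; rewrite andbF eqxx.
  by rewrite !mxE !eqxx => /eqP; rewrite oner_eq0.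
split; [have /rV_neq0P[j] := nz | have /rV_neq0P[j] : row i T2 != 0].
- by rewrite mxE; exists j.
- by apply: contra_neq nz => /z.
- by rewrite mxE; exists j.
Qed.

(** No row of [T1] or [T2] vanishes, so coherent dimensions of the join read their bits from
    coherent columns on both sides and carry the same label. A coherent [w] killing [X] thus stays
    in one block; normality of both sides makes [w *m T1] and [w *m T2] zero, and [blk_free]
    applies. *)
Lemma normal_join : normal B.
Proof.
have [k [X [T1 [T2 [cs [lab [csE bl ->]]]]]]] := join_relP joinB.
have labP i : class_pairs (aV A1) (aV A2) (lab i).
  by rewrite -[class_pairs _ _ _]csE (blk_lab bl).
have coT1 : coherent_mx (aV A1) T1.
  move=> i; have /andP[c1 _] := labP i.
  by apply: supported_coherent c1 _; apply: (blk_sup1 bl).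
have coT2 : coherent_mx (aV A2) T2.
  move=> i; have /andP[_ c2] := labP i.
  by apply: supported_coherent c2 _; apply: (blk_sup2 bl).
move=> w /= cw wX; apply/eqP; apply: contraT => /rV_neq0P[i wi].
have lab_w l : w 0 l != 0 -> lab l = lab i.
  move=> wl; have /coherentP co := cw _ _ wl wi.
  have [[j Tj] [j' Tj']] := row_neq0_joined l csE bl.
  have [[h Th] [h' Th']] := row_neq0_joined i csE bl.
  have /andP[cl1 cl2] := labP l; have /andP[ci1 ci2] := labP i.
  rewrite [lab l]surjective_pairing [lab i]surjective_pairing; congr (_, _).
    apply: (coh_classes_eq (i := j) (j := h) cl1 ci1).
    - by apply: (blk_sup1 bl); rewrite mxE.
    - by apply: (blk_sup1 bl); rewrite mxE.
    - apply/coherentP => ra raV; have := co (tri T1 ra.1, T1 *m ra.2).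
      rewrite mem_cat map_f //= => /(_ isT).
      by rewrite (tri_coherent coT1 raV Tj) (tri_coherent coT1 raV Th).
  apply: (coh_classes_eq (i := j') (j := h') cl2 ci2).
  - by apply: (blk_sup2 bl); rewrite mxE.
  - by apply: (blk_sup2 bl); rewrite mxE.
  - apply/coherentP => ra raV; have := co (tri T2 ra.1, T2 *m ra.2).
    rewrite mem_cat orbC map_f //= => /(_ isT).
    by rewrite (tri_coherent coT2 raV Tj') (tri_coherent coT2 raV Th').
have sup d (T : 'M[rat]_(k, d)) C : (forall l, w 0 l != 0 -> supported (row l T) C) ->
    supported (w *m T) C.
  move=> H j; rewrite mxE; apply: contraR => jC; rewrite big1 // => l _.
  have [->|wl] := eqVneq (w 0 l) 0; first by rewrite mul0r.
  have [->|Tlj] := eqVneq (T l j) 0; first by rewrite mulr0.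
  by case/negP: jC; apply: (H l wl); rewrite mxE.
have /andP[ci1 ci2] := labP i.
have w0 : w = 0.
  apply: (blk_free bl lab_w).
  - apply: norm1; last by rewrite -mulmxA -(blk_X1 bl).
    apply: supported_coherent ci1 _; apply: sup => l /lab_w <-; exact: (blk_sup1 bl).
  - apply: norm2; last by rewrite -mulmxA -(blk_X2 bl).
    apply: supported_coherent ci2 _; apply: sup => l /lab_w <-; exact: (blk_sup2 bl).
by rewrite w0 mxE eqxx in wi.
Qed.

(** Row [i] of [R1] and row [i] of [R2] are coherent and denote the same concrete functional, so
    [blk_onto] factors the pair through one block; stacking the factors gives the mediating matrix
    [Q]. *)
Lemma preceq_join (D : abs n) : preceq A1 D -> preceq A2 D -> preceq B D.
Proof.
have [k [X [T1 [T2 [cs [lab [csE bl ->]]]]]]] := join_relP joinB.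
have labP i : class_pairs (aV A1) (aV A2) (lab i).
  by rewrite -[class_pairs _ _ _]csE (blk_lab bl).
move=> [R1 [sR1 E1]] [R2 [sR2 E2]].
have cR1 := simulates_coherent sR1; have cR2 := simulates_coherent sR2.
have /fin_all_exists[q qP] i : exists w : 'rV_k,
    [/\ w *m T1 = row i R1, w *m T2 = row i R2 &
     forall l, w 0 l != 0 ->
      (exists j j', [/\ T1 l j != 0, R1 i j' != 0 & coherent (aV A1) j j']) /\
      (exists j j', [/\ T2 l j != 0, R2 i j' != 0 & coherent (aV A2) j j'])].
  have E : row i R1 *m aS A1 = row i R2 *m aS A2 by rewrite -!row_mul E1 E2.
  (* By normality the two rows vanish together: either [w = 0] works, or both rows have a coherence
     class. *)
  have z : row i R1 = 0 <-> row i R2 = 0.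
    split=> z; [apply: norm2 (cR2 i) _ | apply: norm1 (cR1 i) _].
      by rewrite -E z mul0mx.
    by rewrite E z mul0mx.
  have [z1|nz1] := eqVneq (row i R1) 0.
    exists 0; rewrite !mul0mx z1 (proj1 z z1); split=> // l.
    by rewrite mxE eqxx.
  have nz2 : row i R2 != 0 by apply: contra_neq nz1 => /z.
  have [C1 C1V s1] := coherent_row_class (cR1 i) nz1.
  have [C2 C2V s2] := coherent_row_class (cR2 i) nz2.
  have pcs : (C1, C2) \in cs by rewrite csE; apply/andP.
  have [w [wl w1 w2]] := blk_onto bl pcs s1 s2 E.
  exists w; split=> // l /wl ll.
  have [[j Tj] [j' Tj']] := row_neq0_joined l csE bl.
  have /rV_neq0P[h h1] := nz1; have /rV_neq0P[h' h2] := nz2.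
  split; [exists j, h | exists j', h']; split=> //; try by move: h1 h2; rewrite !mxE.
    apply: (coh_classes_coherent C1V); last exact: s1.
    by have := @blk_sup1 _ _ _ _ _ _ _ _ _ _ _ bl l j; rewrite ll mxE; apply.
  apply: (coh_classes_coherent C2V); last exact: s2.
  by have := @blk_sup2 _ _ _ _ _ _ _ _ _ _ _ bl l j'; rewrite ll mxE; apply.
pose Q := \matrix_i q i.
have QT1 : Q *m T1 = R1.
  by apply/row_matrixP => i; rewrite row_mul rowK; have [] := qP i.
have QT2 : Q *m T2 = R2.
  by apply/row_matrixP => i; rewrite row_mul rowK; have [] := qP i.
exists Q; split=> /=; last by rewrite (blk_X1 bl) mulmxA QT1.
apply: simulates_cat.
- apply: simulates_image QT1 sR1 _.
    move=> i; have /andP[c1 _] := labP i.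
    by apply: supported_coherent c1 _; apply: (blk_sup1 bl).
  by move=> i l; rewrite mxE => Ql; have [_ _ /(_ l Ql)[]] := qP i.
- apply: simulates_image QT2 sR2 _.
    move=> i; have /andP[_ c2] := labP i.
    by apply: supported_coherent c2 _; apply: (blk_sup2 bl).
  by move=> i l; rewrite mxE => Ql; have [_ _ /(_ l Ql)[]] := qP i.
Qed.
End JoinFacts.

(** * The abstraction of a cube *)

(** Vectors of [Q] outside the current row space are adjoined one by one; [m] bounds the
    codimension, which drops each time. *)
Lemma subspace_matrix N (Q : 'rV[rat]_N -> Prop) :
  Q 0 -> (forall c u v, Q u -> Q v -> Q (c *: u + v)) ->
  exists D : 'M[rat]_N, forall w, (w <= D)%MS <-> Q w.
Proof.
move=> Q0 Qlin.
suff H m : forall D : 'M[rat]_N, (forall w, (w <= D)%MS -> Q w) -> (N - \rank D <= m)%N ->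
    exists D' : 'M[rat]_N, forall w, (w <= D')%MS <-> Q w.
  apply: (H (N - 0)%N 0); last by rewrite mxrank0.
  by move=> w; rewrite submx0 => /eqP->.
elim: m => [|m IH] D DQ rD; case: (classic (forall w, Q w -> (w <= D)%MS)) => [QD|];
  try by exists D => w; split; [exact: DQ | exact: QD].
all: move=> /not_all_ex_not[w] nQD.
all: have [Qw /negP wD] := imply_to_and _ _ nQD.
  by case/negP: wD; rewrite submx_full // /row_full eqn_leq rank_leq_col -subn_eq0 -leqn0.
apply: (IH (D + w)%MS).
  move=> x /sub_addsmxP[[a b] /= ->].
  rewrite addrC [b]mx11_scalar mul_scalar_mx.
  by apply: Qlin => //; apply: DQ; exact: submxMl.
have lt : (\rank D < \rank (D + w)%MS)%N.
  rewrite ltn_neqAle mxrankS ?addsmxSl // andbT; apply: contra wD => /eqP E.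
  by rewrite (submx_trans (addsmxSr D w)) // -(geq_leqif (mxrank_leqif_sup (addsmxSl D w))) E.
by move: rD lt (rank_leq_col (D + w)%MS); lia.
Qed.

Lemma basis_exists n (P : 'rV[rat]_n -> rat -> Prop) :
  P 0 0 -> (forall c s a s' a', P s a -> P s' a' -> P (c *: s + s') (c * a + a')) ->
  exists m (B : 'M[rat]_(m, n)) (a : 'cV[rat]_m), is_basis P B a.
Proof.
move=> P0 Plin.
have [||D HD] := @subspace_matrix (n + 1) (fun w => P (lsubmx w) (rsubmx w 0 0)).
- by rewrite !linear0 mxE.
- move=> c u v Pu Pv; rewrite linearP.
  have -> : rsubmx (c *: u + v) 0 0 = c * rsubmx u 0 0 + rsubmx v 0 0 by rewrite !mxE.
  exact: Plin.
exists _, (lsubmx (row_base D)), (rsubmx (row_base D)); rewrite /is_basis hsubmxK.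
split; first exact: row_base_free.
by move=> s x; rewrite eq_row_base HD row_mxKl row_mxKr mxE eqxx mulr1n.
Qed.

Section AlphaHat.
Variables (n : nat) (ints : seq nat) (C : cube n).

Lemma alpha_hat_exists : exists A, alpha_hat ints C A.
Proof.
have [||m1 [B1 [a1 b1]]] := @basis_exists n (Res ints C).
- by move=> M _ _; rewrite mul0mx; apply/rowP => i; rewrite !mxE mul0rn.
- move=> c s a s' a' H H' M ok sat.
  by rewrite mulmxDl -scalemxAl H // H' // scale_scalar_mx raddfD.
have [||m2 [B2 [a2 b2]]] := @basis_exists n (Inc ints C).
- by move=> M _ _; rewrite !mul0mx add0r; apply/rowP => i; rewrite !mxE mul0rn.
- move=> c s a s' a' H H' M ok sat.
  rewrite !mulmxDl -!scalemxAl H // H' // scalerDr scale_scalar_mx addrACA.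
  by rewrite -raddfD.
by eexists; exists m1, m2, B1, a1, B2, a2.
Qed.

Lemma basis_row m (P : 'rV[rat]_n -> rat -> Prop) (B : 'M[rat]_(m, n)) a i :
  is_basis P B a -> P (row i B) (a i 0).
Proof.
move=> [_ H]; apply/H; suff -> : row_mx (row i B) (a i 0)%:M = row i (row_mx B a).
  exact: row_sub.
rewrite row_row_mx; congr row_mx; apply/rowP => j.
by rewrite !mxE !ord1.
Qed.

Lemma basis_comb m (P : 'rV[rat]_n -> rat -> Prop) (B : 'M[rat]_(m, n)) a s x :
  is_basis P B a -> P s x -> exists w : 'rV_m, w *m B = s /\ w *m a = x%:M.
Proof.
move=> [_ H] /H/submxP[w]; rewrite mul_mx_row => /eq_row_mx[-> ->].
by exists w.
Qed.

(** [is_basis] frees only the augmented rows. If [w] kills [B], then [P 0] holds of the remaining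
    entry [w *m a], which must therefore be 0. For [Res] and [Inc] this condition on [P] comes from
    consistency of the cube. *)
Lemma basis_free m (P : 'rV[rat]_n -> rat -> Prop) (B : 'M[rat]_(m, n)) a (w : 'rV_m) :
  is_basis P B a -> (forall x, P 0 x -> x = 0) -> w *m B = 0 -> w = 0.
Proof.
move=> [fB H] P0 wB; apply: (row_free_inj fB); rewrite mul_mx_row wB mul0mx.
suff -> : w *m a = 0 by rewrite row_mx0.
rewrite [w *m a]mx11_scalar (P0 ((w *m a) 0 0)) ?raddf0 //.
by apply/H; rewrite -mx11_scalar -wB -mul_mx_row submxMl.
Qed.

Variables (A : abs n) (M0 : model n).
Hypotheses (alphaA : alpha_hat ints C A) (ok0 : model_ok ints M0) (sat0 : sat_cube M0 C).

Lemma gamma_alpha_hat M :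
  model_ok ints M -> sat_cube M C -> gamma A (mpre M) (mpost M).
Proof.
move=> ok sat; have [m1 [m2 [B1 [a1 [B2 [a2 [b1 [b2 ->]]]]]]]] := alphaA.
eexists; first exact: mem_head.
rewrite /= !mul_col_mx; apply/colP => i; rewrite !mxE.
case: (split i) => j; rewrite !mxE.
  have /rowP/(_ 0) := basis_row j b1 M ok sat.
  rewrite !mxE eqxx mulr1n mul0r add0r => <-.
  by apply: eq_bigr => k _; rewrite mxE.
have /rowP/(_ 0) := basis_row j b2 M ok sat.
rewrite !mxE eqxx mulr1n mul1r => E.
transitivity (\sum_k row j B2 0 k * mpost M k 0); first by apply: eq_bigr => k _; rewrite mxE.
by rewrite E; congr (_ + _); apply: eq_bigr => k _; rewrite mxE.
Qed.

(** The single transformer resets the [Res] rows and keeps the [Inc] rows, so a coherent [u] uses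
    only one of the two blocks, whose rows are free because the cube has the model [M0]. *)
Lemma normal_alpha_hat : normal A.
Proof.
have [m1 [m2 [B1 [a1 [B2 [a2 [b1 [b2 ->]]]]]]]] := alphaA.
move=> u /= cu; rewrite -[u]hsubmxK; set u1 := lsubmx u; set u2 := rsubmx u.
rewrite mul_row_col => E.
have [z1|/rV_neq0P[i ui]] := eqVneq u1 0.
  move: E; rewrite z1 mul0mx add0r => /(basis_free b2) ->; first by rewrite row_mx0.
  move=> x /(_ _ ok0 sat0); rewrite !mul0mx add0r => /rowP/(_ 0).
  by rewrite !mxE eqxx mulr1n.
have z2 : u2 = 0.
  apply/eqP; apply: contraT => /rV_neq0P[j uj].
  have := cu (lshift _ i) (rshift _ j).
  move: ui uj; rewrite !mxE => ui uj /(_ ui uj).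
  by rewrite /coherent /= !mxE (unsplitK (inl i)) (unsplitK (inr j)) !mxE.
move: E; rewrite z2 mul0mx addr0 => /(basis_free b1) ->; first by rewrite row_mx0.
by move=> x /(_ _ ok0 sat0); rewrite mul0mx => /rowP/(_ 0); rewrite !mxE eqxx mulr1n.
Qed.

(** Bit [i] of [sb] decides whether row [i] of [aS D] satisfies a [Res] or an [Inc] equation;
    expanding the row in that basis alone makes the bits agree. *)
Lemma preceq_alpha_hat (D : abs n) sb :
  sb \in aV D ->
  (forall M, model_ok ints M -> sat_cube M C ->
     aS D *m mpost M = vmul sb.1 (aS D *m mpre M) + sb.2) ->
  preceq A D.
Proof.
move=> sbD H; have [m1 [m2 [B1 [a1 [B2 [a2 [b1 [b2 ->]]]]]]]] := alphaA.
have rowE i (v : 'cV_n) : row i (aS D) *m v = ((aS D *m v) i 0)%:M.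
  by rewrite -row_mul; apply/rowP => j; rewrite !ord1 !mxE eqxx mulr1n.
have postE i M : model_ok ints M -> sat_cube M C ->
    (aS D *m mpost M) i 0 = (nat_of_bool (sb.1 i 0))%:R * (aS D *m mpre M) i 0 + sb.2 i 0.
  by move=> ok sat; rewrite H // [LHS]mxE [vmul _ _ _ _]mxE.
have /fin_all_exists[q qP] i : exists w : 'rV_(m1 + m2),
    [/\ w *m col_mx B1 B2 = row i (aS D), w *m col_mx a1 a2 = (sb.2 i 0)%:M &
     forall k, w 0 k != 0 ->
       (col_mx (const_mx false) (const_mx true) : 'cV[bool]_(m1 + m2)) k 0 = sb.1 i 0].
  case r: (sb.1 i 0).
    have [|w [wB wa]] := @basis_comb _ _ _ _ (row i (aS D)) (sb.2 i 0) b2.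
      move=> M ok sat; by rewrite !rowE postE // r mul1r raddfD.
    exists (row_mx 0 w); rewrite !mul_row_col !mul0mx !add0r; split=> // k.
    by rewrite !mxE; case: (split k) => j; rewrite !mxE ?eqxx.
  have [|w [wB wa]] := @basis_comb _ _ _ _ (row i (aS D)) (sb.2 i 0) b1.
    by move=> M ok sat; rewrite rowE postE // r mul0r add0r.
  exists (row_mx w 0); rewrite !mul_row_col !mul0mx !addr0; split=> // k.
  by rewrite !mxE; case: (split k) => j; rewrite !mxE ?eqxx.
exists (\matrix_i q i); split; last first.
  by apply/row_matrixP => i; rewrite row_mul rowK; have [] := qP i.
apply/simulatesP => ra; rewrite inE => /eqP->; exists sb => //=; split.
  apply/row_matrixP => i; rewrite row_mul rowK; have [_ -> _] := qP i.
  by apply/rowP => j; rewrite !mxE !ord1 eqxx mulr1n.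
by move=> i k; rewrite mxE; have [_ _] := qP i; apply.
Qed.
End AlphaHat.

(** * Skolemization and disjunctive normal form *)

Fixpoint quantifier_free n (f : lira n) : bool :=
  match f with
  | FAtom _ => true
  | FAnd f g | FOr f g => quantifier_free f && quantifier_free g
  | FExQ _ _ | FExZ _ _ => false
  end.

Lemma skol_quantifier_free n (f : lira n) ren next :
  quantifier_free (skol ren next f).1.1.
Proof.
elim: f ren next => [a|f IHf g IHg|f IHf g IHg|k f IHf|k f IHf] ren next //=.
- case E: (skol ren next f) => [[f' n1] i1]; case E': (skol ren n1 g) => [[g' n2] i2] /=.
  by have := IHf ren next; have := IHg ren n1; rewrite E E' /= => -> ->.
- case E: (skol ren next f) => [[f' n1] i1]; case E': (skol ren n1 g) => [[g' n2] i2] /=.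
  by have := IHf ren next; have := IHg ren n1; rewrite E E' /= => -> ->.
- by set ren' := (fun _ => _); have := IHf ren' next.+1; case: (skol _ _ _) => [[]].
Qed.

(** Without integer Skolem constants [model_ok] is vacuous, which frees the convexity argument from
    integrality constraints. *)
Lemma skol_LRA n (f : lira n) ren next : is_LRA f -> (skol ren next f).2 = [::].
Proof.
elim: f ren next => [a|f IHf g IHg|f IHf g IHg|k f IHf|k f IHf] ren next //=.
- move=> [lf lg].
  case E: (skol ren next f) => [[f' n1] i1]; case E': (skol ren n1 g) => [[g' n2] i2] /=.
  by have := IHf ren next lf; have := IHg ren n1 lg; rewrite E E' /= => -> ->.
- move=> [lf lg].
  case E: (skol ren next f) => [[f' n1] i1]; case E': (skol ren n1 g) => [[g' n2] i2] /=.
  by have := IHf ren next lf; have := IHg ren n1 lg; rewrite E E' /= => -> ->.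
- exact: IHf.
Qed.

Lemma skol_range n (f : lira n) ren next f' n' ints :
  skol ren next f = (f', n', ints) ->
  (next <= n')%N /\ forall x, x \in ints -> (next <= x < n')%N.
Proof.
elim: f ren next f' n' ints => [a|f IHf g IHg|f IHf g IHg|k f IHf|k f IHf] ren next f' n' ints /=.
- by move=> [_ <- <-].
- case E: (skol ren next f) => [[f1 n1] i1]; case E': (skol ren n1 g) => [[g' n2] i2] [_ <- <-].
  have [l1 r1] := IHf _ _ _ _ _ E; have [l2 r2] := IHg _ _ _ _ _ E'.
  by split=> [|x]; [lia | rewrite mem_cat => /orP[/r1|/r2]; lia].
- case E: (skol ren next f) => [[f1 n1] i1]; case E': (skol ren n1 g) => [[g' n2] i2] [_ <- <-].
  have [l1 r1] := IHf _ _ _ _ _ E; have [l2 r2] := IHg _ _ _ _ _ E'.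
  by split=> [|x]; [lia | rewrite mem_cat => /orP[/r1|/r2]; lia].
- by move=> /IHf[l r]; split=> [|x /r]; lia.
- set ren' := (fun _ => _); case E: (skol _ _ f) => [[f1 n1] i1] [_ <- <-].
  have [l r] := IHf _ _ _ _ _ E.
  by split=> [|x]; [lia | rewrite inE => /orP[/eqP->|/r]; lia].
Qed.

Section Skolem.
Variables (n : nat) (u v : 'cV[rat]_n).

Definition renamed_on (bs : seq nat) (ren : nat -> nat) (e e' : nat -> rat) :=
  forall k, k \in bs -> e k = e' (ren k).

Lemma eval_rename bs ren e e' (t : term n) :
  renamed_on bs ren e e' -> term_closed_in bs t ->
  eval_term u v e' (rename_term ren t) = eval_term u v e t.
Proof.
move=> ee; elim: t => [[i|i|k]|q|t IH t' IH'|q t IH] //=.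
- by move=> /ee.
- by move=> /andP[/IH-> /IH'->].
- by move=> /IH->.
Qed.

Lemma holds_atom_rename bs ren e e' (a : atom n) :
  renamed_on bs ren e e' -> atom_closed_in bs a ->
  holds_atom u v e' (rename_atom ren a) <-> holds_atom u v e a.
Proof.
by move=> ee; case: a => s t /= /andP[cs ct]; rewrite !(eval_rename ee).
Qed.

Definition int_valued (ints : seq nat) (e : nat -> rat) :=
  forall k, k \in ints -> exists z : int, e k = z%:~R.

Lemma skol_sound f ren next bs e e' :
  renamed_on bs ren e e' -> closed_in bs f ->
  int_valued (skol ren next f).2 e' ->
  holds u v e' (skol ren next f).1.1 -> holds u v e f.
Proof.
have upd_renamed bs' ren' e1 e2 k m : renamed_on bs' ren' e1 e2 ->
    renamed_on (k :: bs') (fun j => if j == k then m else ren' j) (upd e1 k (e2 m)) e2.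
  move=> ee j; rewrite inE /upd; case: eqP => //= _; exact: ee.
elim: f ren next bs e => [a|f IHf g IHg|f IHf g IHg|k f IHf|k f IHf] ren next bs e ee /=.
- by move=> ca _ /(holds_atom_rename ee ca).
- case E: (skol ren next f) => [[f1 n1] i1]; case E': (skol ren n1 g) => [[g' n2] i2] /=.
  move=> /andP[cf cg] ok [hf hg]; split.
    by apply: (IHf ren next bs) => //; rewrite E //= => k ki; apply: ok; rewrite mem_cat ki.
  by apply: (IHg ren n1 bs) => //; rewrite E' //= => k ki; apply: ok; rewrite mem_cat ki orbT.
- case E: (skol ren next f) => [[f1 n1] i1]; case E': (skol ren n1 g) => [[g' n2] i2] /=.
  move=> /andP[cf cg] ok [hf|hg]; [left|right].
    by apply: (IHf ren next bs) => //; rewrite E //= => k ki; apply: ok; rewrite mem_cat ki.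
  by apply: (IHg ren n1 bs) => //; rewrite E' //= => k ki; apply: ok; rewrite mem_cat ki orbT.
(* The value of the Skolem constant [next] is the witness for the bound variable. *)
- move=> cf ok hf; exists (e' next); apply: (IHf _ _ (k :: bs) _ _ cf ok hf).
  exact: upd_renamed.
- set ren' := (fun _ => _) => cf ok hf.
  have [z z_next] : exists z : int, e' next = z%:~R.
    by apply: ok; case: (skol _ _ _) => [[? ?] ?]; rewrite mem_head.
  exists z; rewrite -z_next; apply: (IHf ren' next.+1 (k :: bs)) => //.
  + exact: upd_renamed.
  + move=> j ji; apply: ok; move: ji; case: (skol _ _ _) => [[? ?] ?] /=.
    by rewrite inE orbC => ->.
  + by move: hf; case: (skol _ _ _) => [[? ?] ?].
Qed.

(* The Skolem values can be perturbed freely from [n'] on: this is what lets the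
   conjuncts be Skolemized one after the other. *)
Lemma skol_complete f ren next bs e e' f' n' ints :
  skol ren next f = (f', n', ints) ->
  renamed_on bs ren e e' -> (forall k, k \in bs -> (ren k < next)%N) ->
  closed_in bs f -> holds u v e f ->
  exists2 e1, {in gtn next, e1 =1 e'} &
    forall e2, {in gtn n', e2 =1 e1} -> int_valued ints e2 /\ holds u v e2 f'.
Proof.
have upd_renamed bs' ren' e1 e2 k m q : (forall k, k \in bs' -> (ren' k < m)%N) ->
    renamed_on bs' ren' e1 e2 ->
    renamed_on (k :: bs') (fun j => if j == k then m else ren' j) (upd e1 k q) (upd e2 m q).
  move=> lt ee j; rewrite inE /upd; case: eqP => /= [_ _|_ jb]; first by rewrite eqxx.
  by rewrite ifN ?ee // neq_ltn lt.
have upd_lt bs' ren' k m : (forall k, k \in bs' -> (ren' k < m)%N) ->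
    forall j, j \in k :: bs' -> ((if j == k then m else ren' j) < m.+1)%N.
  by move=> lt j; rewrite inE; case: eqP => //= _ /lt; lia.
elim: f ren next bs e e' f' n' ints =>
  [a|f IHf g IHg|f IHf g IHg|k f IHf|k f IHf] ren next bs e e' f' n' ints /=.
- move=> [<- <- <-] ee lt ca ha; exists e' => // e2 e2E; split=> //.
  have ee2 : renamed_on bs ren e e2 by move=> j jb; rewrite e2E ?ee // inE; exact: lt.
  exact/(holds_atom_rename ee2 ca).
- case E: (skol ren next f) => [[f1 n1] i1]; case E': (skol ren n1 g) => [[g' n2] i2].
  move=> [<- <- <-] ee lt /andP[cf cg] [hf hg].
  have [l1 _] := skol_range E; have [l2 _] := skol_range E'.
  have [e1 e1E H1] := IHf _ _ _ _ _ _ _ _ E ee lt cf hf.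
  have ee1 : renamed_on bs ren e e1.
    by move=> j jb; rewrite e1E ?ee // inE; exact: lt.
  have lt1 j : j \in bs -> (ren j < n1)%N by move=> /lt; lia.
  have [e2 e2E H2] := IHg _ _ _ _ _ _ _ _ E' ee1 lt1 cg hg.
  exists e2 => [j|e3 e3E].
    by rewrite inE => jl; rewrite e2E ?e1E // inE; lia.
  have [|ok1 h1] := H1 e3.
    by move=> j; rewrite inE => jl; rewrite e3E ?e2E // inE; lia.
  have [//|ok2 h2] := H2 e3.
  by split=> // j; rewrite mem_cat => /orP[/ok1|/ok2].
- case E: (skol ren next f) => [[f1 n1] i1]; case E': (skol ren n1 g) => [[g' n2] i2].
  move=> [<- <- <-] ee lt /andP[cf cg].
  have [l1 r1] := skol_range E; have [l2 r2] := skol_range E'.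
  case=> [hf|hg].
    have [e1 e1E H1] := IHf _ _ _ _ _ _ _ _ E ee lt cf hf.
    (* The integer constants of [g] must be integers even though only [f] is known to hold; they lie
       from [n1] on, where 0 is assigned. *)
    exists (fun j => if (j < n1)%N then e1 j else 0) => [j|e2 e2E].
      by rewrite inE => jl; rewrite ifT ?e1E //; lia.
    have [|ok1 h1] := H1 e2.
      by move=> j; rewrite inE => jl; rewrite e2E ?jl // inE; lia.
    split; last by left.
    move=> j; rewrite mem_cat => /orP[/ok1//|/r2 jr]; exists 0.
    by rewrite e2E ?inE ?ifN //; lia.
  (* Symmetrically, values from [next] on start at 0, and those of the constants of [f], below [n1],
     remain so. *)
  have [|j /lt|e1 e1E H1] := IHg _ _ _ _ (fun j => if (j < next)%N then e' j else 0)
    _ _ _ E' _ _ cg hg.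
  + by move=> j jb; rewrite lt // ee.
  + by lia.
  exists e1 => [j|e2 e2E].
    by rewrite inE => jl; rewrite e1E ?jl // inE; lia.
  have [//|ok1 h1] := H1 e2; split; last by right.
  move=> j; rewrite mem_cat => /orP[/r1 jr|/ok1//]; exists 0.
  by rewrite e2E ?e1E ?inE ?ifN //; lia.
- set ren' := (fun _ => _) => E ee lt cf [q hq].
  have [||e1 e1E H1] := IHf _ _ (k :: bs) _ (upd e' next q) _ _ _ E _ _ cf hq.
  + exact: upd_renamed.
  + exact: upd_lt.
  exists e1 => // j; rewrite inE => jl; rewrite e1E ?inE ?(leqW jl) // /upd ifN //; lia.
- set ren' := (fun _ => _); case E: (skol ren' next.+1 f) => [[f1 n1] i1].
  move=> [<- <- <-] ee lt cf [z hz].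
  have [||e1 e1E H1] := IHf _ _ (k :: bs) _ (upd e' next z%:~R) _ _ _ E _ _ cf hz.
  + exact: upd_renamed.
  + exact: upd_lt.
  exists e1 => [j|e2 e2E].
    by rewrite inE => jl; rewrite e1E ?inE ?(leqW jl) // /upd ifN //; lia.
  have [ok h] := H1 e2 e2E; have [l _] := skol_range E; split=> // j.
  rewrite inE => /orP[/eqP->|/ok//]; exists z.
  by rewrite e2E ?inE // e1E ?inE // /upd eqxx.
Qed.
End Skolem.

Lemma In_allpairs (T U V : Type) (h : T -> U -> V) (s : seq T) (t : seq U) z :
  List.In z [seq h x y | x <- s, y <- t] <->
  exists x y, [/\ List.In x s, List.In y t & z = h x y].
Proof.
elim: s => [|x s IH] /=; first by split=> // -[x [y []]].
split=> [/List.in_app_iff[|/IH[x' [y [xs yt ->]]]]|].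
- by move=> /List.in_map_iff[y [<- yt]]; exists x, y; split=> //; left.
- by exists x', y; split=> //; right.
- move=> [x' [y [[<-|xs] yt zE]]]; apply/List.in_app_iff.
    by left; apply/List.in_map_iff; exists y.
  by right; apply/IH; exists x', y.
Qed.

Lemma dnfP n (f : lira n) (M : model n) : quantifier_free f ->
  holds (mpre M) (mpost M) (msk M) f <-> exists2 C, List.In C (dnf f) & sat_cube M C.
Proof.
elim: f => [a|f IHf g IHg|f IHf g IHg|//|//] /=.
- move=> _; split=> [ha|[C [<-|//] H]]; last by apply: H; left.
  by exists [:: a]; [left | move=> b [<-|]].
- move=> /andP[qf qg]; rewrite (IHf qf) (IHg qg); split.
    move=> [[C Cf sC] [D Dg sD]]; exists (C ++ D).
      by apply/In_allpairs; exists C, D.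
    by move=> a /List.in_app_iff[/sC|/sD].
  move=> [E /In_allpairs[C [D [Cf Dg ->]]] sE].
  split; [exists C => // | exists D => //]; move=> a aC; apply: sE; apply/List.in_app_iff.
    by left.
  by right.
- move=> /andP[qf qg]; rewrite (IHf qf) (IHg qg); split.
    by move=> [[C Cf sC]|[D Dg sD]]; [exists C | exists D] => //; apply/List.in_app_iff;
      [left | right].
  by move=> [C /List.in_app_iff[Cf|Cg] sC]; [left | right]; exists C.
Qed.

Lemma skG_sound n (F : lira n) M : is_transition_formula F -> model_ok (skInts F) M ->
  holds (mpre M) (mpost M) (msk M) (skG F) -> trans F (mpre M) (mpost M).
Proof. by move=> cF; apply: (@skol_sound n _ _ F id 0 [::]). Qed.

Lemma skG_complete n (F : lira n) u v : is_transition_formula F -> trans F u v ->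
  exists sk, let M := Model u v sk in
    model_ok (skInts F) M /\ holds (mpre M) (mpost M) (msk M) (skG F).
Proof.
move=> cF hF; rewrite /skInts /skG; case E: (skol id 0 F) => [[f' n'] ints].
have [//|//|e1 _ H] := skol_complete (bs := [::]) (e' := fun=> 0) E _ _ cF hF.
by exists e1; apply: H.
Qed.

(** * Convexity of cubes *)

(** The Skolem constants are interpolated too, so that every term is affine along the segment.
    Integrality is lost, hence the restriction of the best-abstraction claim to LRA. *)
Definition comb_model n (t : rat) (M N : model n) : model n :=
  Model ((1 - t) *: mpre M + t *: mpre N) ((1 - t) *: mpost M + t *: mpost N)
        (fun k => (1 - t) * msk M k + t * msk N k).

Lemma eval_comb_model n t (M N : model n) (s : term n) :
  let ev P := eval_term (mpre P) (mpost P) (msk P) s in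
  ev (comb_model t M N) = (1 - t) * ev M + t * ev N.
Proof.
elim: s => [[i|i|k]|q|s /= IH s' IH'|q s /= IH] //=; rewrite ?mxE //.
- ring.
- by rewrite IH IH'; ring.
- by rewrite IH; ring.
Qed.

Lemma sat_cube_convex n t (M N : model n) C : 0 <= t <= 1 ->
  sat_cube M C -> sat_cube N C -> sat_cube (comb_model t M N) C.
Proof.
move=> t01 sM sN a aC; move: (sM a aC) (sN a aC).
case: a aC => s s' _; rewrite /holds_atom !eval_comb_model.
  (* Only a positive factor preserves strictness, so [t = 0] is separate; for [t > 0] the second
     summand is strict and the first weak. *)
  move=> lM lN; have [t0|t0] := eqVneq t 0; first by rewrite t0; lra.
  have tp : 0 < t by lra.
  apply: ler_ltD; last by rewrite ltr_pM2l.
  by apply: ler_wpM2l; lra.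
by move=> -> ->.
Qed.

Lemma cube_single_transformer n (C : cube n) (D : abs n) (M0 : model n) :
  sat_cube M0 C ->
  (forall M, sat_cube M C -> gamma D (mpre M) (mpost M)) ->
  exists2 sb, sb \in aV D & forall M, sat_cube M C ->
     aS D *m mpost M = vmul sb.1 (aS D *m mpre M) + sb.2.
Proof.
move=> sat0 cov.
pose f (sb : 'cV[bool]_(ad D) * 'cV[rat]_(ad D)) (M : model n) :=
  aS D *m mpost M - (vmul sb.1 (aS D *m mpre M) + sb.2).
have [|||sb sbD H] := @affine_cover (model n) 'cV[rat]_(ad D) _ (@comb_model n) f
    (fun M => sat_cube M C) _ _ (aV D) M0 sat0.
- move=> sb t M N; rewrite /f /= !(mulmxDr, vmulD, =^~ scalemxAr, vmulZ).
  move: (_ *m mpost M) (_ *m mpost N) (vmul _ (_ *m mpre M)) (vmul _ (_ *m mpre N)) => a b c d.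
  by apply/colP => i; rewrite !mxE; ring.
- by move=> t M N t01; exact: sat_cube_convex.
- by move=> M /cov[sb sbD E]; exists sb => //; rewrite /f E subrr.
exists sb => // M /H /eqP; rewrite /f subr_eq0 => /eqP//.
Qed.

(** * The algorithm *)

Section Algorithm.
Variables (n : nat) (F : lira n).
Hypothesis closedF : is_transition_formula F.

(** [inv_gamma] supplies a cube for the next iteration, [inv_cover] gives soundness once Γ is
    unsatisfiable, and [inv_normal] makes the next join least, which preserves [inv_best]. *)
Record invariant (s : alg_state n) : Prop := Invariant {
  inv_gamma : forall M, st_gamma s M -> holds (mpre M) (mpost M) (msk M) (skG F);
  inv_cover : forall M, holds (mpre M) (mpost M) (msk M) (skG F) ->
    st_gamma s M \/ gamma (st_abs s) (mpre M) (mpost M);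
  inv_normal : normal (st_abs s);
  inv_best : is_LRA F -> forall D, is_abstraction F D -> preceq (st_abs s) D }.

Lemma invariant_init : invariant (init_state F).
Proof.
split=> //=.
- by move=> M; left.
- by move=> u /= _; rewrite mulmx1.
(* The initial [V] is empty, so any matrix is a simulation; the identity as concrete matrix forces
   [aS D]. *)
- move=> _ D _; exists (aS D); split; last by rewrite mulmx1.
  by move=> u v [].
Qed.

(** [inv_cover] survives because [gamma] only grows under joins. For [inv_best], one transformer of
    [D] answers the whole cube, so [A'] lies below [D], and so does the join. *)
Lemma invariant_step s t : alg_step F s t -> invariant s -> invariant t.
Proof.
case=> A G M C A' B ok GM CF sat alphaC joinB [/= iG icov inorm ibest].
have norm' : normal A' := normal_alpha_hat alphaC ok sat.
split=> /=.
- by move=> M' [/iG].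
- move=> M' /icov[GM'|gA].
    by case: (classic (gamma B (mpre M') (mpost M'))); [right | left].
  by right; exact: gamma_joinl joinB _ _ gA.
- exact: normal_join joinB inorm norm'.
- move=> lra D absD; apply: preceq_join joinB inorm norm' _ (ibest lra D absD) _.
  have ints0 : skInts F = [::] := skol_LRA _ _ lra.
  have [M' satM'|sb sbD H] := @cube_single_transformer n C D M sat.
    apply: absD; apply: skG_sound closedF _ _; first by rewrite ints0.
    by apply/dnfP; [exact: skol_quantifier_free | exists C].
  by apply: (preceq_alpha_hat alphaC sbD) => M' _; exact: H.
Qed.

Lemma invariant_reach s t : alg_reach F s t -> invariant s -> invariant t.
Proof. by elim=> // {}s {}t w /invariant_step st _ IH /st. Qed.

(* Each iteration removes its cube for good from the cubes meeting the current formula. *)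
Lemma alg_terminates : Acc (fun t s => alg_step F s t) (init_state F).
Proof.
pose alive (s : alg_state n) C :=
  List.In C (dnf (skG F)) /\
  exists M, [/\ model_ok (skInts F) M, st_gamma s M & sat_cube M C].
(* The measure is the length of a list containing all alive cubes; each iteration cuts one
   occurrence of its cube out of the list. *)
suff H m (L : seq (cube n)) s : size L = m -> (forall C, alive s C -> List.In C L) ->
    Acc (fun t s => alg_step F s t) s.
  by apply: (H _ (dnf (skG F))) => // C [].
elim: m L s => [|m IH] L s sL al; constructor=> t st; case: st al.
  move=> A G M C A' B ok GM CF sat _ _ al.
  have := al C (conj CF (ex_intro _ M (And3 ok GM sat))).
  by rewrite (size0nil sL).
move=> A G M C A' B ok GM CF sat alphaC joinB al.
have CL := al C (conj CF (ex_intro _ M (And3 ok GM sat))).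
have [L1 [L2 LE]] := List.in_split _ _ CL.
apply: (IH (L1 ++ L2)) => [|D [DF [M' [ok' [/= GM' nB] sat']]]].
  by move: sL; rewrite LE !size_cat /= addnS => -[].
have := al D (conj DF (ex_intro _ M' (And3 ok' GM' sat'))).
rewrite LE => /List.in_app_iff[DL|[CD|DL]]; try by apply/List.in_app_iff; tauto.
(* Were the chosen cube still alive, its model [M'] would satisfy [gamma A'], hence [gamma B], which
   the new formula excludes. *)
case: nB; apply: gamma_joinr joinB _ _ _.
by apply: (gamma_alpha_hat alphaC ok'); rewrite CD.
Qed.

Lemma alg_progress s : invariant s -> gamma_sat F s -> exists t, alg_step F s t.
Proof.
case: s => A G /inv_gamma /= iG [M [ok /= GM]].
have /dnfP[] := iG M GM; first exact: skol_quantifier_free.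
move=> C CF sat; have [A' alphaC] := alpha_hat_exists (skInts F) C.
have [B joinB] := join_exists A A'.
eexists; exact: AlgStep ok GM CF sat alphaC joinB.
Qed.

Lemma alg_sound s : invariant s -> ~ gamma_sat F s -> is_abstraction F (st_abs s).
Proof.
move=> inv nsat u v uv; have [sk [ok hM]] := skG_complete closedF uv.
by have [GM|//] := inv_cover inv hM; case: nsat; exists (Model u v sk).
Qed.
End Algorithm.

(* For every ∃LIRA transition formula F of dimension n:
   (1) every run of abstract-VASR on F is finite (no infinite chain of loop iterations);
   (2) a run never gets stuck: whenever Γ is satisfiable, an iteration can be performed;
   (3) every returned (S, V) (loop exits because Γ is unsatisfiable) is a Q-VASR
       abstraction of F, and a best one when F is in ∃LRA. *)
Theorem theorem2 (n : nat) (F : lira n) :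
  is_transition_formula F ->
  Acc (fun t s => alg_step F s t) (init_state F) /\
  (forall s, alg_reach F (init_state F) s -> gamma_sat F s ->
     exists t, alg_step F s t) /\
  (forall s, alg_reach F (init_state F) s -> ~ gamma_sat F s ->
     is_abstraction F (st_abs s) /\
     (is_LRA F -> is_best_abstraction F (st_abs s))).
Proof.
move=> closedF.
have inv s : alg_reach F (init_state F) s -> invariant F s.
  by move=> r; apply: invariant_reach r (invariant_init F).
split; first exact: alg_terminates.
split=> s /inv iv; first exact: alg_progress.
move=> nsat; have absF := alg_sound closedF iv nsat.
by split=> // lraF; split=> // D; exact: (inv_best iv).
Qed.
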